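(* Let $\Gamma$ be a two-ended highly-arc-transitive digraph of prime out-valency $p$ such that $m>2$, where $m$ is the common cardinality of the fibres $\varphi^{-1}(i)$, $i\in\mathbb Z$, of a surjective digraph homomorphism $\varphi:\Gamma\to\vec{\mathbb Z}$. Then the alternets of $\Gamma$ are complete bipartite digraphs with $p$ vertices in each side, i.e. isomorphic to $\vec K_{p,p}$.
   Context: A digraph $\Gamma=(V\Gamma,E\Gamma)$ has vertex set $V\Gamma$ and arc set $E\Gamma\subseteq V\Gamma\times V\Gamma$. It is connected if its underlying undirected graph is connected. ''Out-valency $p$'' means that every vertex $v$ has exactly $p$ out-neighbours (vertices $u$ with $(v,u)\in E\Gamma$). A $k$-arc is a sequence of vertices $v_0,\dots,v_k$ with $(v_i,v_{i+1})\in E\Gamma$ for $0\le i<k$ (a 0-arc is a vertex). $\Gamma$ is highly-arc-transitive if $\mathrm{Aut}(\Gamma)$ is transitive on the $k$-arcs for all $k$. A ray is a one-way infinite path (in the underlying undirected graph) with distinct vertices. The ends of a digraph are the equivalence classes of rays, where two rays are equivalent if there is an infinite family of pairwise disjoint paths (ignoring directions) each having its initial vertex in one ray and terminal vertex in the other. A digraph is two-ended if it is connected and has exactly two ends. $\vec{\mathbb Z}$ is the digraph with vertex set $\mathbb Z$ and arcs $(i,i+1)$, $i\in\mathbb Z$; a digraph homomorphism is a map on vertices sending arcs to arcs (preserving direction). Every two-ended highly-arc-transitive digraph of positive out-valency admits a surjective digraph homomorphism $\varphi:\Gamma\to\vec{\mathbb Z}$, unique up to adding an integer constant, and its fibres are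 finite and all of the same size $m$. Two arcs are related if they have a common initial vertex or a common terminal vertex; the subdigraphs spanned by the classes of the transitive closure of this relation (an equivalence relation on arcs) are the alternets of $\Gamma$. $\vec K_{r,s}$ is the digraph obtained from the complete bipartite graph $K_{r,s}$ by directing all edges from the side with $r$ vertices to the side with $s$ vertices. *)

(* Defs.v *)
From Stdlib Require Export Relation_Operators.
From mathcomp Require Export all_boot all_order all_algebra.
From mathcomp Require Export classical_sets functions cardinality.

Set Implicit Arguments.
Unset Strict Implicit.
Unset Printing Implicit Defensive.

Local Open Scope ring_scope.
Local Open Scope classical_set_scope.
Local Open Scope card_scope.

Record digraph := Digraph {
  vertex :> Type;
  arc : vertex -> vertex -> Prop
}.

Definition dhom (G H : digraph) (f : G -> H) : Prop :=
  forall u v : G, arc u v -> arc (f u) (f v).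

Definition diso (G H : digraph) (f : G -> H) : Prop :=
  bijective f /\ forall u v : G, arc u v <-> arc (f u) (f v).

Definition isomorphic (G H : digraph) : Prop := exists f : G -> H, diso f.

Definition adjacent (G : digraph) (u v : G) : Prop := arc u v \/ arc v u.

(* Paths and rays live in the underlying undirected graph. A path of length 0
   is a single vertex. *)
Record upath (G : digraph) := UPath {
  upath_len : nat;
  upath_fun :> 'I_upath_len.+1 -> G;
  upath_inj : injective upath_fun;
  upath_adj : forall i j : 'I_upath_len.+1,
    j = i.+1 :> nat -> adjacent (upath_fun i) (upath_fun j)
}.

Record ray (G : digraph) := Ray {
  ray_fun :> nat -> G;
  ray_inj : injective ray_fun;
  ray_adj : forall n : nat, adjacent (ray_fun n) (ray_fun n.+1)
}.

Definition connected (G : digraph) : Prop :=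
  forall u v : G, exists P : upath G, P ord0 = u /\ P ord_max = v.

Definition disjoint_paths (G : digraph) (P Q : upath G) : Prop :=
  forall i j, P i <> Q j.

(* Paths have at least one vertex, so pairwise disjointness makes the family
   [P] injective, hence infinite. *)
Definition ray_equiv (G : digraph) (r s : ray G) : Prop :=
  exists P : nat -> upath G,
    (forall i j : nat, i <> j -> disjoint_paths (P i) (P j)) /\
    (forall i : nat, range r (P i ord0) /\ range s (P i ord_max)).

Definition ends (G : digraph) : set (set (ray G)) :=
  range (fun r : ray G => [set s | ray_equiv r s]).

Arguments ends : clear implicits.

Definition two_ended (G : digraph) : Prop :=
  connected G /\ ends G #= `I_2.

Definition out_valency (G : digraph) (p : nat) : Prop :=
  forall v : G, [set u : G | arc v u] #= `I_p.

(* Vertices of a k-arc may repeat. *)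
Definition is_karc (G : digraph) (k : nat) (v : 'I_k.+1 -> G) : Prop :=
  forall i j : 'I_k.+1, j = i.+1 :> nat -> arc (v i) (v j).

Definition highly_arc_transitive (G : digraph) : Prop :=
  forall (k : nat) (v w : 'I_k.+1 -> G), is_karc v -> is_karc w ->
    exists f : G -> G, diso f /\ forall i, f (v i) = w i.

Definition vecZ : digraph := @Digraph int (fun i j => j = i + 1).

Definition vecK (r s : nat) : digraph :=
  @Digraph ('I_r + 'I_s)%type (fun x y =>
    match x, y with inl _, inr _ => True | _, _ => False end).

Definition arc_type (G : digraph) : Type := {a : G * G | arc a.1 a.2}.

Definition tail (G : digraph) (a : arc_type G) : G := (sval a).1.
Definition head (G : digraph) (a : arc_type G) : G := (sval a).2.

Definition arc_related (G : digraph) (a b : arc_type G) : Prop :=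
  tail a = tail b \/ head a = head b.

(* [arc_related] is reflexive and symmetric, so its transitive closure is
   already an equivalence relation. *)
Definition same_alternet (G : digraph) : arc_type G -> arc_type G -> Prop :=
  clos_trans (arc_type G) (@arc_related G).

(* The subdigraph spanned by the class of [a]: its arcs are the arcs of the
   class, its vertices their end-points. *)
Definition alternet (G : digraph) (a : arc_type G) : digraph :=
  @Digraph
    {v : G | exists b, same_alternet a b /\ (v = tail b \/ v = head b)}
    (fun u v => exists b,
       same_alternet a b /\ tail b = sval u /\ head b = sval v).

(* Main.v *)
(** Write F_i for the fibre of phi over i and K_i for the group of automorphisms
    fixing F_i pointwise.  If every K_i fixed F_{i+1} pointwise, an automorphism
    preserving the fibres would be determined on all later fibres by its action
    on the finite set F_0, while p^k images of a single k-arc starting in F_0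
    must be realised for every k.  So some element of K_i moves an out-neighbour
    of some v in F_i.  As K_i is normal in the stabiliser of v, which is
    transitive on the p out-neighbours of v, the K_i-orbits there have equal
    size, and primality of p leaves a single orbit.  Any in-neighbour w of one
    of these vertices lies in F_i, hence is fixed by K_i and has the same
    out-neighbours as v. *)
From mathcomp Require Import all_boot all_order all_algebra.
From mathcomp Require Import boolp classical_sets functions cardinality.
Require Import Defs.

Local Open Scope classical_set_scope.
Local Open Scope card_scope.

Import GRing.Theory.

(** * Finite enumerations, isomorphisms, and high arc-transitivity on short walks *)

Lemma card_eq_II_enum (T : Type) (A : set T) (n : nat) :
  A #= `I_n ->
  exists e : 'I_n -> T, injective e /\ forall x, A x <-> exists i, e i = x.
Proof.
move=> /card_set_bijP[f [fA finj fsurj]].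
have /choice[e eP] : forall i : 'I_n, exists x, A x /\ f x = i.
  by move=> i; have [x Ax <-] := fsurj i (ltn_ord i); exists x.
exists e; split=> [i j eij|x].
  by apply: val_inj; rewrite /= -(eP i).2 -(eP j).2 eij.
split=> [Ax|[i <-]]; last exact: (eP i).1.
exists (Ordinal (fA x Ax)).
by apply: finj; rewrite ?inE ?(eP _).2 //; exact: (eP _).1.
Qed.

Lemma inj_surj_bij (T U : Type) (f : T -> U) :
  injective f -> (forall y, exists x, f x = y) -> bijective f.
Proof.
move=> finj /choice[g gP]; exists g => // x.
by apply: finj; rewrite gP.
Qed.

Lemma diso_comp (G H L : digraph) (f : G -> H) (g : H -> L) :
  diso f -> diso g -> diso (g \o f).
Proof.
move=> [fb fa] [gb ga]; split; first exact: bij_comp.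
by move=> u v; split=> [/fa/ga|/ga/fa].
Qed.

Lemma diso_inv (G H : digraph) (f : G -> H) :
  diso f -> exists g : H -> G, [/\ diso g, cancel f g & cancel g f].
Proof.
move=> [[g fK gK] fa]; exists g; split=> //; split; first by exists f.
by move=> u v; rewrite -{1}(gK u) -{1}(gK v); split=> /fa.
Qed.

Lemma hat_walk (G : digraph) (k : nat) (v w : nat -> G) :
  highly_arc_transitive G ->
  (forall i, i < k -> arc (v i) (v i.+1)) ->
  (forall i, i < k -> arc (w i) (w i.+1)) ->
  exists f : G -> G, diso f /\ forall i, i <= k -> f (v i) = w i.
Proof.
move=> hat va wa.
have karc (x : nat -> G) : (forall i, i < k -> arc (x i) (x i.+1)) ->
    is_karc (fun i : 'I_k.+1 => x i).
  by move=> xa i j ij; rewrite ij; apply: xa; rewrite -ltnS -ij.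
have [f [fi fP]] := hat k _ _ (karc v va) (karc w wa).
by exists f; split=> // i ik; exact: (fP (Ordinal (ik : i < k.+1))).
Qed.

Lemma hat_vertex (G : digraph) (u v : G) :
  highly_arc_transitive G -> exists f : G -> G, diso f /\ f u = v.
Proof.
move=> hat.
have [|| f [fi fP]] := @hat_walk G 0 (fun=> u) (fun=> v) hat => //.
by exists f; split=> //; exact: (fP 0).
Qed.

Lemma hat_arc (G : digraph) (u v u' v' : G) :
  highly_arc_transitive G -> arc u v -> arc u' v' ->
  exists f : G -> G, [/\ diso f, f u = u' & f v = v'].
Proof.
move=> hat uv uv'.
have [|| f [fi fP]] := @hat_walk G 1 (fun n => if n is 0 then u else v)
  (fun n => if n is 0 then u' else v') hat.
- by case.
- by case.
by exists f; split=> //; [exact: (fP 0) | exact: (fP 1)].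
Qed.

(** Crossing one edge of a path, in either direction, changes [phi x] and [phi (f x)] by the same
    amount, so their difference is constant along a path from [u] to [v]. *)
Lemma diso_shift (G : digraph) (phi : G -> int) (f : G -> G) (u v : G) :
  connected G -> (forall x y, arc x y -> phi y = phi x + 1)%R -> diso f ->
  (phi (f u) - phi u = phi (f v) - phi v)%R.
Proof.
move=> conn phiS [_ fa]; have [P [<- <-]] := conn u v.
suff H n (lt_n : n < (upath_len P).+1) :
    (phi (f (P ord0)) - phi (P ord0) =
     phi (f (P (Ordinal lt_n))) - phi (P (Ordinal lt_n)))%R.
  by rewrite (H _ (ltnSn _)); congr (phi (f (P _)) - phi (P _))%R; apply: val_inj.
elim: n lt_n => [|n IHn] lt_n.
  by congr (phi (f (P _)) - phi (P _))%R; apply: val_inj.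
rewrite (IHn (ltnW lt_n)).
have [Pa|Pa] := @upath_adj G P (Ordinal (ltnW lt_n)) (Ordinal lt_n) erefl.
  by rewrite (phiS _ _ Pa) (phiS _ _ ((fa _ _).1 Pa)) opprD addrACA subrr addr0.
by rewrite (phiS _ _ Pa) (phiS _ _ ((fa _ _).1 Pa)) opprD addrACA subrr addr0.
Qed.

(** * Automorphisms fixing one fibre pointwise and moving the next *)

Definition fixes_fibre (G : digraph) (phi : G -> int) (i : int) (f : G -> G) :=
  forall x, phi x = i -> f x = x.

(** Encodes walks by bit strings, so that counting walks of length k becomes counting k-tuples of
    booleans. *)
Fixpoint walk (T : Type) (s : bool -> T -> T) (v : T) (b : nat -> bool)
    (n : nat) : T :=
  if n is n'.+1 then s (b n') (walk T s v b n') else v.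

Lemma out_choice (G : digraph) (p : nat) : 1 < p -> out_valency G p ->
  exists s : bool -> G -> G,
    (forall b v, arc v (s b v)) /\ forall v, injective (s^~ v).
Proof.
move=> p_gt1 val.
have /choice[t tP] (v : G) : exists t : bool -> G,
    (forall b, arc v (t b)) /\ injective t.
  have [e [einj eP]] := card_eq_II_enum _ _ _ (val v).
  exists (fun b => e (if b then Ordinal p_gt1 else Ordinal (ltnW p_gt1))).
  split=> [b|b b' /einj]; first by apply/eP; eexists.
  by case: b b' => [] [] // /(congr1 val).
by exists (fun b v => t v b); split=> [b|] v; case: (tP v) => // + _; apply.
Qed.

(** Pigeonhole: otherwise a fibre-preserving automorphism is determined on every F_n with n >= 0 by
    its action on F_0. Two choices per step already give 2^k walks of length k from [v0], too many
    for the m^m self-maps of F_0 once k = m^m. *)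
Lemma exists_mover (G : digraph) (p m : nat) (phi : G -> int) :
  connected G -> highly_arc_transitive G -> 1 < p -> out_valency G p ->
  (forall x y, arc x y -> phi y = phi x + 1)%R ->
  (exists v, phi v = 0)%R ->
  phi @^-1` [set 0%R] #= `I_m ->
  exists i f u, [/\ diso f, fixes_fibre G phi i f, phi u = (i + 1)%R & f u <> u].
Proof.
move=> conn hat p_gt1 val phiS [v0 v00] /card_eq_II_enum[e [einj eP]].
apply: contrapT => noex.
have fixS i f : diso f -> fixes_fibre G phi i f -> fixes_fibre G phi (i + 1)%R f.
  move=> fi ff u ui; apply: contrapT => fu.
  by apply: noex; exists i, f, u.
have fixN f (n : nat) : diso f -> fixes_fibre G phi 0%R f ->
    fixes_fibre G phi n%:Z%R f.
  move=> fi f0; elim: n => // n IHn.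
  by rewrite -addn1 PoszD; exact: fixS.
have [s [sa sinj]] := out_choice G p p_gt1 val.
pose w b := walk G s v0 b.
have wa b n : arc (w b n) (w b n.+1) by exact: sa.
have phiw b n : phi (w b n) = n%:Z%R.
  by elim: n => // n IHn; rewrite (phiS _ _ (wa b n)) IHn -addn1 PoszD.
pose k := (m ^ m)%N.
pose bits (b : k.-tuple bool) (n : nat) := nth false b n.
have /choice[f fP] (b : k.-tuple bool) : exists f : G -> G, diso f /\
    forall i, i <= k -> f (w xpred0 i) = w (bits b) i.
  by apply: hat_walk.
(* [f b] fixes [v0], the common start of all the walks, so its shift is zero. *)
have phif b x : phi (f b x) = phi x.
  apply/eqP; rewrite -subr_eq0.
  have [fi fw] := fP b.
  rewrite (diso_shift G phi (f b) x v0 conn phiS fi).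
  by rewrite (fw 0 (leq0n k)) subrr.
have /choice[r rP] (b : k.-tuple bool) : exists r : {ffun 'I_m -> 'I_m},
    forall i, e (r i) = f b (e i).
  have /choice[r rP] (i : 'I_m) : exists j, e j = f b (e i).
    by apply/eP; rewrite /= phif; apply/eP; exists i.
  by exists (finfun r) => i; rewrite ffunE.
have rinj : injective r.
  move=> b b' rbb'.
  have [[fi fw] [fi' fw']] := (fP b, fP b').
  have [g [gi fK gK]] := diso_inv _ _ _ fi'.
  (* [f b] and [f b'] act alike on F_0, so [g \o f b] fixes F_0 pointwise, hence all later fibres,
     and both carry the reference walk to the same walk. *)
  have fix0 : fixes_fibre G phi 0%R (g \o f b).
    by move=> x /eP[i <-]; rewrite /= -rP rbb' rP fK.
  have agree n : n <= k -> w (bits b) n = w (bits b') n.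
    move=> nk; rewrite -fw // -fw' // -[LHS]gK; congr (f b').
    exact: (fixN _ n (diso_comp _ _ _ _ _ fi gi) fix0 _ (phiw _ _)).
  apply/val_inj/(@eq_from_nth _ false) => [|n]; rewrite !size_tuple // => nk.
  (* Agreement at steps n and n+1 recovers the n-th bit, as [s] is injective in its bit. *)
  have := agree n.+1 nk; rewrite /w /= -/(w _ n) -/(w _ n) agree ?(ltnW nk) //.
  exact: sinj.
have := leq_card r rinj.
by rewrite card_tuple card_bool card_ffun !card_ord leqNgt ltn_expl.
Qed.

(** * Transitivity on the out-neighbours of a vertex *)

(* The relation plays the role of the orbits of a normal subgroup of a
   transitive group on a set of prime size. *)
Lemma prime_orbits (p : nat) (R : rel 'I_p) :
  prime p -> equivalence_rel R ->
  (forall x y, exists s : 'I_p -> 'I_p,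
     [/\ injective s, s x = y & forall z t, R z t -> R (s z) (s t)]) ->
  (exists x y, R x y /\ x != y) ->
  forall x y, R x y.
Proof.
move=> pp Req Rtr [x0 [y0 [Rxy0 neq0]]].
have Rin : {in [set: 'I_p]%SET & &, equivalence_rel R} by move=> x y z *.
(* [s] injects the class of [x] into the class of [y]; exchanging the two gives equal sizes. *)
have le x y : #|[set z | R x z]%SET| <= #|[set z | R y z]%SET|.
  have [s [sinj <- sR]] := Rtr x y.
  rewrite -(card_imset _ sinj); apply: subset_leq_card.
  by apply/fintype.subsetP => _ /imsetP[z + ->]; rewrite !inE => /sR.
have eqc x y : #|[set z | R x z]%SET| = #|[set z | R y z]%SET|.
  by apply/eqP; rewrite eqn_leq !le.
have parts := equivalence_partitionP Rin.
have blocks (A : {set 'I_p}) : A \in equivalence_partition R [set: 'I_p]%SET ->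
    #|A| = #|[set z | R x0 z]%SET|.
  move=> /imsetP[x _ ->]; rewrite (eqc x0 x).
  by apply: eq_card => z; rewrite !inE.
have := card_uniform_partition blocks parts.
rewrite cardsT card_ord => pE.
have : #|[set z | R x0 z]%SET| %| p by apply/dvdnP; exact: ex_intro pE.
move=> /(primeP pp).2 /orP[/eqP c1|/eqP cp] x y.
  have : #|[set x0; y0]%SET| <= 1.
    rewrite -c1; apply: subset_leq_card; apply/fintype.subsetP => z.
    by rewrite !inE => /orP[] /eqP -> //; have [] := Req x0 x0 x0.
  by rewrite cards2 neq0.
have : y \in [set z | R x z]%SET.
  suff -> : [set z | R x z]%SET = [set: 'I_p]%SET by rewrite inE.
  by apply/eqP; rewrite eqEcard finset.subsetT cardsT card_ord (eqc x x0) cp leqnn.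
by rewrite inE.
Qed.

(** The primality argument is run at a single vertex [v0], found through [exists_mover]; conjugation
    then carries the result to every vertex. *)
Lemma fibre_stabiliser_transitive (G : digraph) (p m : nat) (phi : G -> int) :
  connected G -> highly_arc_transitive G -> prime p -> out_valency G p ->
  (forall x y, arc x y -> phi y = phi x + 1)%R ->
  (exists v, phi v = 0)%R ->
  phi @^-1` [set 0%R] #= `I_m ->
  forall v u u', arc v u -> arc v u' ->
    exists f, [/\ diso f, fixes_fibre G phi (phi v) f & f u = u'].
Proof.
move=> conn hat pp val phiS phi0 fib0.
have shift f x y : diso f -> phi x = phi y -> phi (f x) = phi (f y).
  move=> fi xy; apply: (addIr (- phi x)%R).
  by rewrite (diso_shift G phi f x y conn phiS fi) xy.
(* Since [h] permutes the fibres, conjugation by it moves pointwise stabilisers of fibres to one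
   another. With [h] fixing [v0] this is normality; with other [h] it changes the base vertex. *)
have fixJ f g h v : diso h -> cancel h g -> cancel g h ->
    fixes_fibre G phi (phi v) f -> fixes_fibre G phi (phi (h v)) (h \o f \o g).
  move=> hi hK gK ff x xv; rewrite /= ff ?gK //.
  have [g' [gi' hK' gK']] := diso_inv _ _ _ hi.
  have gE : g =1 g' by move=> y; rewrite -{1}(gK' y) hK.
  by rewrite gE -(hK' v); exact: shift.
have [i [f0 [u0 [f0i f0f u0i f0u]]]] :=
  exists_mover G p m phi conn hat (prime_gt1 pp) val phiS phi0 fib0.
(* An automorphism taking some out-neighbour of [u0] to [u0] takes [u0] to an in-neighbour of
   [u0]. *)
have [v0 v0u0] : exists v, arc v u0.
  have [e [_ eP]] := card_eq_II_enum _ _ _ (val u0).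
  have u0a : arc u0 (e (Ordinal (prime_gt0 pp))) by apply/eP; eexists.
  have [h [[_ ha] hE]] := hat_vertex G (e (Ordinal (prime_gt0 pp))) u0 hat.
  by exists (h u0); rewrite -[X in arc _ X]hE; exact: (ha _ _).1.
have iE : i = phi v0 by apply: (addIr 1%R); rewrite -u0i; exact: phiS.
subst i.
have tr0 u u' : arc v0 u -> arc v0 u' ->
    exists f, [/\ diso f, fixes_fibre G phi (phi v0) f & f u = u'].
  have [e [einj eP]] := card_eq_II_enum _ _ _ (val v0).
  have eA j : arc v0 (e j) by apply/eP; exists j.
  pose R (x y : 'I_p) := `[< exists f,
    [/\ diso f, fixes_fibre G phi (phi v0) f & f (e x) = e y] >].
  have Rrefl x : R x x.
    apply/asboolP; exists id; split=> //; split=> //; by exists id.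
  have Rsym x y : R x y -> R y x.
    move=> /asboolP[f [fi ff fE]]; apply/asboolP.
    have [g [gi fK gK]] := diso_inv _ _ _ fi.
    exists g; split=> // [z zv|]; last by rewrite -fE fK.
    by rewrite -{1}(ff z zv) fK.
  have Rtrans x y z : R x y -> R y z -> R x z.
    move=> /asboolP[f [fi ff fE]] /asboolP[g [gi gf gE]]; apply/asboolP.
    exists (g \o f); split; rewrite /= ?fE //; first exact: diso_comp.
    by move=> t tv; rewrite /= ff ?gf.
  have allR : forall x y, R x y.
    apply: prime_orbits => //.
    - move=> x y z; split=> // Rxy.
      by apply/idP/idP => [/(Rtrans _ _ _ (Rsym _ _ Rxy))|/(Rtrans _ _ _ Rxy)].
    (* The permutation [s] is induced by an automorphism [h] fixing [v0] with [h (e x) = e y]; it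
       respects [R] by normality. *)
    - move=> x y.
      have [h [hi hv hE]] := hat_arc G v0 (e x) v0 (e y) hat (eA x) (eA y).
      have [g [gi hK gK]] := diso_inv _ _ _ hi.
      have /choice[s sP] j : exists j', e j' = h (e j).
        by apply/eP; rewrite /= -{1}hv; exact: (hi.2 _ _).1.
      exists s; split=> [a b sab||z t /asboolP[f [fi ff fE]]].
      + by apply: einj; apply: (can_inj hK); rewrite -!sP sab.
      + by apply: einj; rewrite sP.
      apply/asboolP; exists (h \o f \o g); split.
      + by apply: diso_comp => //; apply: diso_comp.
      + by rewrite -{1}hv; apply: fixJ.
      by rewrite /= !sP hK fE.
    have /eP[x xE] := v0u0.
    have /eP[y yE] : arc v0 (f0 u0).
      by rewrite -(f0f v0 erefl); exact: (f0i.2 _ _).1.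
    exists x, y; split; last by apply/eqP => xy; apply: f0u; rewrite -yE -xy xE.
    by apply/asboolP; exists f0; rewrite xE yE.
  by move=> /eP[x <-] /eP[y <-]; exact/asboolP/allR.
move=> v u u' vu vu'.
have [h [hi hE]] := hat_vertex G v0 v hat.
have [g [gi hK gK]] := diso_inv _ _ _ hi.
have arcg x : arc v x -> arc v0 (g x) by move=> vx; rewrite -(hK v0) hE; exact: (gi.2 _ _).1.
have [f [fi ff fE]] := tr0 _ _ (arcg _ vu) (arcg _ vu').
exists (h \o f \o g); split.
- by apply: diso_comp => //; apply: diso_comp.
- by rewrite -hE; apply: fixJ.
- by rewrite /= fE gK.
Qed.

(** * Counting in-neighbours *)

(** Double counting between two consecutive fibres of size m: the rows contribute m * p arcs, and
    vertex-transitivity makes the m column sums equal, so each is p. *)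
Lemma in_valency (G : digraph) (p m : nat) (phi : G -> int) (u : G) :
  highly_arc_transitive G -> out_valency G p -> 0 < m ->
  (forall x y, arc x y -> phi y = phi x + 1)%R ->
  (forall i, phi @^-1` [set i] #= `I_m) ->
  exists e : 'I_p -> G, injective e /\ forall x, arc x u <-> exists i, e i = x.
Proof.
move=> hat val m_gt0 phiS fib.
have [e1 [e1inj e1P]] := card_eq_II_enum _ _ _ (fib (phi u)).
have [e0 [e0inj e0P]] := card_eq_II_enum _ _ _ (fib (phi u - 1)%R).
pose A (x y : 'I_m) := `[< arc (e0 x) (e1 y) >].
have e0E x : phi (e0 x) = (phi u - 1)%R by apply/e0P; exists x.
have e1E y : phi (e1 y) = phi u by apply/e1P; exists y.
have row x : #|[set y | A x y]%SET| = p.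
  have [e [einj eP]] := card_eq_II_enum _ _ _ (val (e0 x)).
  have /choice[t tP] j : exists y, e1 y = e j.
    have /eP ej : exists i, e i = e j by exists j.
    by apply/e1P; rewrite /= (phiS _ _ ej) e0E subrK.
  have tinj : injective t by move=> a b tab; apply: einj; rewrite -!tP tab.
  rewrite -[RHS]card_ord -cardsT -(card_imset _ tinj); apply: eq_card => y.
  rewrite inE; apply/asboolP/imsetP => [/eP[j jE]|[j _ ->]].
    by exists j; rewrite ?inE //; apply: e1inj; rewrite tP.
  by apply/eP; exists j; rewrite tP.
have col_le y y' : #|[set x | A x y]%SET| <= #|[set x | A x y']%SET|.
  have [h [hi hE]] := hat_vertex G (e1 y) (e1 y') hat.
  have [g [gi hK gK]] := diso_inv _ _ _ hi.
  (* [t] follows [h] only on the in-neighbours of [e1 y]; elsewhere the value [x] is a dummy. *)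
  have /choice[t tP] x : exists x', A x y -> e0 x' = h (e0 x).
    have [Axy|] := boolP (A x y); last by exists x.
    have hx : arc (h (e0 x)) (e1 y') by rewrite -hE; apply: (hi.2 _ _).1; apply/asboolP.
    have [x' x'E] : exists x', e0 x' = h (e0 x); last by exists x'.
    apply/e0P; rewrite /=; apply: (addIr 1%R).
    by rewrite -(phiS _ _ hx) e1E subrK.
  rewrite -[X in X <= _](@card_in_imset _ _ t).
    apply: subset_leq_card; apply/fintype.subsetP => _ /imsetP[x + ->].
    rewrite !inE => Axy; rewrite tP; last exact/asboolP.
    by rewrite -hE; exact: (hi.2 _ _).1.
  move=> a b; rewrite !inE => Aa Ab tab; apply: e0inj; apply: (can_inj hK).
  by rewrite -!tP ?tab //; exact/asboolP.
have /e1P[y0 y0E] : (phi @^-1` [set phi u]) u by [].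
have col y : #|[set x | A x y]%SET| = #|[set x | A x y0]%SET|.
  by apply/eqP; rewrite eqn_leq !col_le.
have colp : #|[set x | A x y0]%SET| = p.
  apply/eqP; rewrite -(eqn_pmul2l m_gt0); apply/eqP.
  have -> : m * p = \sum_(x < m) \sum_(y < m) A x y.
    rewrite -[m in LHS]card_ord -sum_nat_const; apply: eq_bigr => x _.
    by rewrite -(row x) -sum1_card big_mkcond /=; apply: eq_bigr => y _; rewrite inE; case: ifP.
  rewrite exchange_big /=.
  transitivity (\sum_(y < m) #|[set x | A x y0]%SET|).
    by rewrite sum_nat_const card_ord.
  apply: eq_bigr => y _; rewrite -(col y) -sum1_card big_mkcond /=.
  by apply: eq_bigr => x _; rewrite inE; case: ifP.
rewrite -{}colp.
exists (fun i => e0 (enum_val i)); split; first by move=> i j /e0inj/enum_val_inj.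
move=> x; split=> [xu|[i <-]].
  have /e0P[x' x'E] : (phi @^-1` [set (phi u - 1)%R]) x.
    by rewrite /= (phiS _ _ xu) addrK.
  have x'A : x' \in [set x | A x y0]%SET.
    by rewrite inE; apply/asboolP; rewrite x'E y0E.
  by exists (enum_rank_in x'A x'); rewrite enum_rankK_in.
by have := enum_valP i; rewrite inE => /asboolP; rewrite y0E.
Qed.

(** * The shape of the alternets *)

(** Under [rect] a chain of related arcs collapses to two steps, through the arc from [tail b] to
    [head a]. *)
Lemma same_alternetP (G : digraph) (a b : arc_type G) :
  (forall v w u u' : G, arc v u -> arc w u -> arc v u' -> arc w u') ->
  same_alternet a b <-> arc (tail b) (head a) /\ arc (tail a) (head b).
Proof.
move=> rect; have arcP (c : arc_type G) : arc (tail c) (head c) by case: c.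
have step (c d : arc_type G) : arc_related c d ->
    arc (tail d) (head c) /\ arc (tail c) (head d).
  by move=> [cd|cd]; rewrite -cd; split=> //; rewrite cd.
split=> [|[ba ab]]; last first.
  have ra : arc_related a (exist _ (tail b, head a) ba) by right.
  have rb : arc_related (exist _ (tail b, head a) ba) b by left.
  by apply: t_trans; apply: t_step; [exact: ra | exact: rb].
elim=> {a b} [c d /step //|c d e _ [dc cd] _ [ed de]].
split; first exact: rect _ _ _ _ (arcP d) ed dc.
exact: rect _ _ _ _ (arcP d) cd de.
Qed.

(** [rect] supplies all arcs between the two sides, while [notrans] keeps the sides disjoint and
    excludes every other arc. *)
Lemma alternet_vecK (G : digraph) (p : nat) (a : arc_type G)
    (e0 e1 : 'I_p -> G) :
  (forall v w u u' : G, arc v u -> arc w u -> arc v u' -> arc w u') ->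
  (forall x y z : G, arc x y -> arc y z -> ~ arc x z) ->
  injective e0 -> (forall x, arc x (head a) <-> exists i, e0 i = x) ->
  injective e1 -> (forall x, arc (tail a) x <-> exists i, e1 i = x) ->
  isomorphic (alternet a) (vecK p p).
Proof.
move=> rect notrans e0inj e0P e1inj e1P.
have arca : arc (tail a) (head a) by case: (a).
have altP b := same_alternetP G a b rect.
have e0a i : arc (e0 i) (head a) by apply/e0P; exists i.
have e1a i : arc (tail a) (e1 i) by apply/e1P; exists i.
have e01 i j : arc (e0 i) (e1 j) by exact: rect _ _ _ _ arca (e0a i) (e1a j).
have e0alt i : exists b, same_alternet a b /\ (e0 i = tail b \/ e0 i = head b).
  by exists (exist _ (e0 i, head a) (e0a i)); rewrite altP; split; [exact: conj (e0a i) arca|left].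
have e1alt i : exists b, same_alternet a b /\ (e1 i = tail b \/ e1 i = head b).
  by exists (exist _ (tail a, e1 i) (e1a i)); rewrite altP; split; [exact: conj arca (e1a i)|right].
pose g (x : 'I_p + 'I_p) : alternet a :=
  match x with
  | inl i => exist _ (e0 i) (e0alt i)
  | inr i => exist _ (e1 i) (e1alt i)
  end.
(* The isomorphism is built from [vecK p p], where a vertex shows its side, and then inverted. *)
suff /diso_inv[f [fi _ _]] : @diso (vecK p p) (alternet a) g by exists f.
have ne i j : e0 i <> e1 j.
  (* A common vertex would carry a loop, which contradicts [notrans] at three equal vertices. *)
  by move=> eij; have := e01 i j; rewrite eij => ejj; exact: (notrans _ _ _ ejj ejj ejj).
split.
  apply: inj_surj_bij => [[i|i] [j|j] /(congr1 sval) /=|].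
  - by move=> /e0inj ->.
  - by move=> /ne.
  - by move=> /esym/ne.
  - by move=> /e1inj ->.
  move=> [x xP]; have [b [/altP[/e0P[i iE] /e1P[j jE]] xE]] := xP.
  by case: xE => xE; [exists (inl i)|exists (inr j)]; apply: eq_exist; rewrite xE.
(* If [e1 i] were a tail, then [tail a], [e1 i], [head a] would form a transitive triangle; [hd]
   uses [e0 i] likewise. *)
have tl b i : same_alternet a b -> tail b = e1 i -> False.
  by move=> /altP[ba _] bE; apply: (notrans _ _ _ (e1a i) _ arca); rewrite -bE.
have hd b i : same_alternet a b -> head b = e0 i -> False.
  by move=> /altP[_ ab] bE; apply: (notrans _ _ _ _ (e0a i) arca); rewrite -bE.
move=> [i|i] [j|j]; split=> //=.
- by move=> [b [ab [_ bE]]]; exact: hd ab bE.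
- by move=> _; exists (exist _ (e0 i, e1 j) (e01 i j)); rewrite altP; split; [exact: conj (e0a i) (e1a j)|].
- by move=> [b [ab [bE _]]]; exact: tl ab bE.
- by move=> [b [ab [bE _]]]; exact: tl ab bE.
Qed.

Theorem corollary14 (G : digraph) (p m : nat) (phi : G -> vecZ)
    (Gends : two_ended G) (Ghat : highly_arc_transitive G)
    (p_prime : prime p) (Gval : out_valency G p)
    (phi_hom : dhom phi) (phi_surj : forall i : vecZ, exists v : G, phi v = i)
    (phi_fibres : forall i : vecZ, phi @^-1` [set i] #= `I_m)
    (m_gt2 : (2 < m)%N) :
  forall a : arc_type G, isomorphic (alternet a) (vecK p p).
Proof.
move=> a.
have m_gt0 : 0 < m by exact: leq_trans m_gt2.
have phiS (x y : G) : arc x y -> (phi y = phi x + 1)%R by exact: phi_hom.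
have rect (v w u u' : G) : arc v u -> arc w u -> arc v u' -> arc w u'.
  move=> vu wu vu'.
  have [f [[_ fa] ff <-]] := fibre_stabiliser_transitive G p m phi Gends.1 Ghat
    p_prime Gval phiS (phi_surj 0%R) (phi_fibres 0%R) v u u' vu vu'.
  (* [w] lies in the fibre of [v], so [f] fixes it and carries its arc to [u] onto an arc to
     [f u]. *)
  rewrite -{1}(ff w); first exact: (fa _ _).1.
  by apply: (addIr 1%R); rewrite -(phiS _ _ wu) -(phiS _ _ vu).
have notrans (x y z : G) : arc x y -> arc y z -> ~ arc x z.
  (* From [x] to [z] the value of [phi] would rise by both 1 and 2. *)
  move=> /phiS xy /phiS yz /phiS xz.
  have : (phi x + 1 + 1 = phi x + 1 + 0 :> int)%R by rewrite addr0 -xy -yz xz xy.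
  by move=> /addrI.
have [e0 [e0inj e0P]] :=
  in_valency G p m phi (head a) Ghat Gval m_gt0 phiS phi_fibres.
have [e1 [e1inj e1P]] := card_eq_II_enum _ _ _ (Gval (tail a)).
exact: alternet_vecK rect notrans e0inj e0P e1inj e1P.
Qed.
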